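(* Let $G$ be a finite simple graph with $n\ge1$ vertices and $m\ge1$ edges, let $a_V\le b_V$ and $a_E\le b_E$ be real constants, and let $F_V:\{0,1,2,\dots\}\to(0,\infty)$ and $F_E:\{0,1,2,\dots\}^2\to(0,\infty)$ be functions satisfying $$a_V\le \log F_V(d_u)\le b_V\ \ \forall u\in V(G),\qquad a_E\le \log F_E(d_u,d_v)\le b_E\ \ \forall uv\in E(G).$$ Then $$\frac1n X_{\Sigma,F_V}(G)\le e^{a_V}+e^{b_V}-\frac{e^{a_V+b_V}}{X_{\Pi,F_V}(G)^{1/n}},\qquad \frac1m X_{\Sigma,F_E}(G)\le e^{a_E}+e^{b_E}-\frac{e^{a_E+b_E}}{X_{\Pi,F_E}(G)^{1/m}}.$$
   Context: For a graph $G$ with vertex set $V(G)$ and edge set $E(G)$, $d_u$ denotes the degree of the vertex $u$ and $uv$ denotes the edge joining $u$ and $v$. For a function $F_V$ of one variable and a function $F_E$ of two variables, $X_{\Sigma,F_V}(G)=\sum_{u\in V(G)}F_V(d_u)$, $X_{\Sigma,F_E}(G)=\sum_{uv\in E(G)}F_E(d_u,d_v)$, $X_{\Pi,F_V}(G)=\prod_{u\in V(G)}F_V(d_u)$, and $X_{\Pi,F_E}(G)=\prod_{uv\in E(G)}F_E(d_u,d_v)$. Since $F_E(d_u,d_v)$ is evaluated on unordered edges, $F_E$ is assumed symmetric: $F_E(x,y)=F_E(y,x)$. Here $\log$ is the natural logarithm. *)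

(* Defs.v *)
From mathcomp Require Import all_boot all_order all_algebra.
From mathcomp Require Import reals.

Set Implicit Arguments.
Unset Strict Implicit.
Unset Printing Implicit Defensive.

Import Order.TTheory GRing.Theory Num.Theory.
Local Open Scope ring_scope.

Record sgraph := SGraph {
  vertex :> finType;
  adj : rel vertex;
  adj_sym : symmetric adj;
  adj_irrefl : irreflexive adj
}.

Definition degree (G : sgraph) (u : G) : nat := #|[set v : G | adj u v]|.

(* Edges are unordered: each edge uv is the two-element set [set u; v]. *)
Definition edges (G : sgraph) : {set {set G}} :=
  [set [set p.1; p.2] | p : G * G & adj p.1 p.2].

(* F(d_u, d_v) for the edge e = {u, v}.  An enumeration (u, v) of e is picked;
   for symmetric F the value does not depend on it, see edge_valE.  The default
   is never reached on an edge. *)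
Definition edge_val (R : realType) (G : sgraph) (F : nat -> nat -> R)
    (e : {set G}) : R :=
  if [pick p : G * G | e == [set p.1; p.2]] is Some p
  then F (degree p.1) (degree p.2) else 0.

Lemma edge_valE (R : realType) (G : sgraph) (F : nat -> nat -> R) (u v : G) :
  (forall i j, F i j = F j i) ->
  edge_val F [set u; v] = F (degree u) (degree v).
Proof.
move=> Fsym; rewrite /edge_val; case: pickP => [[x y] /= /eqP E|]; last first.
  by move=> /(_ (u, v)); rewrite eqxx.
have : x \in [set u; v] by rewrite E set21.
have : y \in [set u; v] by rewrite E set22.
have : u \in [set x; y] by rewrite -E set21.
have : v \in [set x; y] by rewrite -E set22.
rewrite !inE => /orP[]/eqP-> /orP[]/eqP-> // /orP[]/eqP yE /orP[]/eqP xE;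
  by rewrite ?yE ?xE // Fsym.
Qed.

Definition XsumV (R : realType) (F : nat -> R) (G : sgraph) : R :=
  \sum_(u : G) F (degree u).

Definition XsumE (R : realType) (F : nat -> nat -> R) (G : sgraph) : R :=
  \sum_(e in edges G) edge_val F e.

Definition XprodV (R : realType) (F : nat -> R) (G : sgraph) : R :=
  \prod_(u : G) F (degree u).

Definition XprodE (R : realType) (F : nat -> nat -> R) (G : sgraph) : R :=
  \prod_(e in edges G) edge_val F e.

(* Main.v *)
(* Each value f lies in [e^a, e^b], so (f - e^a) (e^b - f) >= 0, that is
   f <= e^a + e^b - e^(a+b) / f.  Averaging and bounding the mean of the
   inverses 1/f from below by their geometric mean gives both inequalities. *)

Require Import Defs.
From mathcomp Require Import all_boot all_order all_algebra.
From mathcomp Require Import reals sequences exp.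
From mathcomp Require Import ring.

Set Implicit Arguments.
Unset Strict Implicit.
Unset Printing Implicit Defensive.

Import Order.TTheory GRing.Theory Num.Theory.
Local Open Scope ring_scope.

(** This is AM-GM for the positive numbers [(f i)^-1], whose product is the inverse of the product
    of the [f i]. *)
Lemma invr_geomean_le_mean_inv (R : realType) (I : finType) (A : {pred I})
    (f : I -> R) :
  (0 < #|A|)%N -> {in A, forall i, 0 < f i} ->
  ((\prod_(i in A) f i) `^ #|A|%:R^-1)^-1
    <= #|A|%:R^-1 * \sum_(i in A) (f i)^-1.
Proof.
move=> A_gt0 f_gt0.
have P_gt0 : 0 < \prod_(i in A) f i by apply: prodr_gt0.
have sum_ge0 : 0 <= \sum_(i in A) (f i)^-1.
  by apply: sumr_ge0 => i iA; rewrite invr_ge0 ltW ?f_gt0.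
have inv_ge0 : {in A, forall i, 0 <= (f i)^-1}.
  by move=> i iA; rewrite invr_ge0 ltW ?f_gt0.
(* Both sides are nonnegative, so they may be raised to the power [#|A|]; this removes the root and
   leaves AM-GM in its product form. *)
rewrite -(ler_pXn2r A_gt0) ?nnegrE ?invr_ge0 ?powR_ge0 ?mulr_ge0 ?invr_ge0 //.
rewrite exprVn -powR_mulrn ?powR_ge0// -powRrM mulVf ?pnatr_eq0 -?lt0n//.
rewrite powRr1 ?(ltW P_gt0)// -prodfV mulrC.
by rewrite (leif_AGM inv_ge0).
Qed.

(** An arbitrary [A] lets one argument serve both the vertices and the edges. *)
Lemma mean_le_geomean (R : realType) (I : finType) (A : {pred I})
    (f : I -> R) (a b : R) :
  (0 < #|A|)%N -> {in A, forall i, 0 < f i} ->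
  {in A, forall i, a <= ln (f i) <= b} ->
  #|A|%:R^-1 * \sum_(i in A) f i
    <= expR a + expR b - expR (a + b) / (\prod_(i in A) f i) `^ #|A|%:R^-1.
Proof.
move=> A_gt0 f_gt0 f_ab; set n : R := #|A|%:R.
have n_gt0 : 0 < n by rewrite ltr0n.
have f_le i : i \in A -> f i <= expR a + expR b - expR (a + b) * (f i)^-1.
  move=> iA; have fi0 := f_gt0 _ iA.
  have /andP[] := f_ab _ iA; rewrite -(ler_expR a) -(ler_expR _ b).
  rewrite lnK ?posrE// => af fb.
  (* Multiplying the difference of the two sides by [f i > 0] clears the inverse and gives a
     quadratic that factors. *)
  rewrite -subr_ge0 -(pmulr_lge0 _ fi0) expRD.
  rewrite [leRHS](_ : _ = (f i - expR a) * (expR b - f i)).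
    by rewrite mulr_ge0 ?subr_ge0.
  by field; rewrite gt_eqF.
(* The middle term is the average over [A] of the pointwise bounds [f_le]. *)
apply: (@le_trans _ _
  (expR a + expR b - expR (a + b) * (n^-1 * \sum_(i in A) (f i)^-1))).
  rewrite ler_pdivrMl// (le_trans (ler_sum _ f_le))// sumrB sumr_const -mulr_sumr.
  rewrite -[_ *+ _]mulr_natl -/n mulrBr lerD2l lerN2.
  by rewrite [n * (_ * _)]mulrCA mulVKf ?gt_eqF.
rewrite lerD2l lerN2 ler_wpM2l ?expR_ge0//.
exact: invr_geomean_le_mean_inv.
Qed.

Theorem theorem3 (R : realType) (G : sgraph) (n m : nat)
    (hn : #|G| = n) (hm : #|edges G| = m) (n_ge1 : (1 <= n)%N) (m_ge1 : (1 <= m)%N)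
    (aV bV aE bE : R) (abV : aV <= bV) (abE : aE <= bE)
    (FV : nat -> R) (FE : nat -> nat -> R)
    (FV_gt0 : forall i, 0 < FV i) (FE_gt0 : forall i j, 0 < FE i j)
    (FE_sym : forall i j, FE i j = FE j i)
    (hFV : forall u : G, aV <= ln (FV (degree u)) <= bV)
    (hFE : forall u v : G, adj u v ->
       aE <= ln (FE (degree u) (degree v)) <= bE) :
  n%:R^-1 * XsumV FV G
    <= expR aV + expR bV - expR (aV + bV) / XprodV FV G `^ n%:R^-1 /\
  m%:R^-1 * XsumE FE G
    <= expR aE + expR bE - expR (aE + bE) / XprodE FE G `^ m%:R^-1.
Proof.
(* In this form [edge_valE], with the symmetry of [FE], turns [edge_val] into a value of [FE] at
   adjacent vertices, to which positivity and the bounds apply. *)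
have in_edges e : e \in edges G -> exists u v, [/\ e = [set u; v] & adj u v].
  by case/imsetP => -[u v]; rewrite inE => uv ->; exists u, v.
split.
  by rewrite -hn; apply: mean_le_geomean => [|//|u _]; rewrite ?hn.
rewrite -hm; apply: mean_le_geomean; first by rewrite hm.
  by move=> e /in_edges[u [v [-> _]]]; rewrite edge_valE.
by move=> e /in_edges[u [v [-> uv]]]; rewrite edge_valE ?hFE.
Qed.
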